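(* There is an algorithm which, given a positive integer $n$ and an element $\alpha \in T_{n+1}$ (presented as a word in the generators $s_1,\dots,s_n$), determines whether there exist $\beta \in T_n$ and an integer $i$ with $1 \le i \le n$ such that $$\alpha = (\beta \otimes \mathrm{I})\, s_n s_{n-1} \cdots s_{i+1} s_i s_{i+1} \cdots s_{n-1} s_n \quad \text{in } T_{n+1}.$$ Likewise, there is an algorithm which, given a positive integer $n$ and an element $\alpha \in T_{n+1}$ (presented as a word in the generators $s_1,\dots,s_n$), determines whether there exist $\beta \in T_n$ and an integer $i$ with $1 \le i \le n$ such that $$\alpha = (\mathrm{I} \otimes \beta)\, s_1 s_2 \cdots s_{i-1} s_i s_{i-1} \cdots s_2 s_1 \quad \text{in } T_{n+1}.$$
   Context: For $n \ge 2$, the twin group $T_n$ is the group with presentation $$T_n=\langle s_1, \dots, s_{n-1} \mid s_i^2 = 1 \ (1 \le i \le n-1),\ s_i s_j = s_j s_i \text{ for } |i-j| \ge 2 \rangle,$$ and $T_1$ is the trivial group. For $\beta \in T_n$, the element $\beta \otimes \mathrm{I} \in T_{n+1}$ (geometrically, one adds a single trivial strand to the right of $\beta$) is the image of $\beta$ under the homomorphism $T_n \to T_{n+1}$, $s_k \mapsto s_k$ for $1 \le k \le n-1$. The element $\mathrm{I} \otimes \beta \in T_{n+1}$ (a single trivial strand added to the left of $\beta$) is the image of $\beta$ under the homomorphism $T_n \to T_{n+1}$, $s_k \mapsto s_{k+1}$ for $1 \le k \le n-1$. In the word $s_n s_{n-1} \cdots s_{i+1} s_i s_{i+1} \cdots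 s_{n-1} s_n$ the indices decrease from $n$ to $i$ and then increase from $i+1$ back to $n$ (for $i=n$ the word is just $s_n$). In the word $s_1 s_2 \cdots s_{i-1} s_i s_{i-1} \cdots s_2 s_1$ the indices increase from $1$ to $i$ and then decrease from $i-1$ back to $1$ (for $i=1$ the word is just $s_1$). *)

(* Defs.v *)
From HB Require Import structures.
From mathcomp Require Import all_boot.
From mathcomp Require Import boolp.

Set Implicit Arguments.
Unset Strict Implicit.
Unset Printing Implicit Defensive.

Local Open Scope quotient_scope.

(* The group < X | R >: words in the letters x and x^-1, for x in X, modulo
   the congruence generated by free cancellation and by the relations u = v
   with R u v.  The letter (x, false) is x and the letter (x, true) is x^-1. *)
Definition pres_word (X : Type) := seq (X * bool).

Definition pres_inv_letter (X : Type) (l : X * bool) : X * bool :=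
  (l.1, ~~ l.2).

Definition pres_inv_word (X : Type) (u : pres_word X) : pres_word X :=
  rev (map (@pres_inv_letter X) u).

Inductive pres_cong (X : Type) (R : pres_word X -> pres_word X -> Prop) :
    pres_word X -> pres_word X -> Prop :=
| PresRel u v : R u v -> pres_cong R u v
| PresCancel l : pres_cong R [:: l; pres_inv_letter l] [::]
| PresRefl u : pres_cong R u u
| PresSym u v : pres_cong R u v -> pres_cong R v u
| PresTrans u v w : pres_cong R u v -> pres_cong R v w -> pres_cong R u w
| PresCat u u' v v' :
    pres_cong R u u' -> pres_cong R v v' -> pres_cong R (u ++ v) (u' ++ v').

Section PresentedGroup.
Variables (X : choiceType) (R : pres_word X -> pres_word X -> Prop).

(* Generic quotients need a boolean relation, whence the classical `[< _ >]. *)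
Definition pres_rel : rel (pres_word X) := fun u v => `[< pres_cong R u v >].

Lemma pres_rel_refl : reflexive pres_rel.
Proof. by move=> u; apply/asboolP; apply: PresRefl. Qed.

Lemma pres_rel_sym : symmetric pres_rel.
Proof. by move=> u v; apply/asboolP/asboolP; apply: PresSym. Qed.

Lemma pres_rel_trans : transitive pres_rel.
Proof.
by move=> v u w /asboolP uv /asboolP vw; apply/asboolP; apply: PresTrans uv vw.
Qed.

Canonical pres_equiv :=
  EquivRel pres_rel pres_rel_refl pres_rel_sym pres_rel_trans.

Definition presented := {eq_quot pres_equiv}.
HB.instance Definition _ := Choice.on presented.
HB.instance Definition _ := EqQuotient.on presented.

Definition pres_class (u : pres_word X) : presented := \pi_presented u.

Lemma pres_classP u v : pres_class u = pres_class v <-> pres_cong R u v.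
Proof.
rewrite /pres_class; split=> [/eqmodP /asboolP //|uv].
by apply/eqmodP/asboolP.
Qed.

Lemma pres_class_repr (a : presented) : pres_class (repr a) = a.
Proof. exact: reprK. Qed.

Lemma pres_repr_class u : pres_cong R (repr (pres_class u)) u.
Proof. by apply/pres_classP; rewrite pres_class_repr. Qed.

Lemma pres_inv_wordK : involutive (@pres_inv_word X).
Proof.
move=> u; rewrite /pres_inv_word map_rev revK -map_comp map_id_in // => l _.
by rewrite /= /pres_inv_letter negbK; case: l.
Qed.

Lemma pres_cong_mulVw u : pres_cong R (pres_inv_word u ++ u) [::].
Proof.
rewrite -[X in _ ++ X]pres_inv_wordK; move: (pres_inv_word u) => {}u.
elim/last_ind: u => [|u l IHu]; first exact: PresRefl.
have -> : pres_inv_word (rcons u l) = pres_inv_letter l :: pres_inv_word u.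
  by rewrite /pres_inv_word map_rcons rev_rcons.
rewrite cat_rcons -(cat1s l) -(cat1s (pres_inv_letter l)).
apply: PresTrans IHu; apply: PresCat; first exact: PresRefl.
rewrite catA -[X in pres_cong R _ X]cat0s.
by apply: PresCat; [exact: PresCancel | exact: PresRefl].
Qed.

Lemma pres_cong_inv u v :
  pres_cong R u v -> pres_cong R (pres_inv_word u) (pres_inv_word v).
Proof.
move=> uv; apply: PresTrans (_ : pres_cong R (pres_inv_word u ++
    (v ++ pres_inv_word v)) _).
  rewrite -[X in pres_cong R X _]cats0; apply: PresCat; first exact: PresRefl.
  apply: PresSym; have := pres_cong_mulVw (pres_inv_word v).
  by rewrite pres_inv_wordK.
rewrite catA -[X in pres_cong R _ X]cat0s; apply: PresCat; last exact: PresRefl.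
apply: PresTrans (pres_cong_mulVw u); apply: PresCat; first exact: PresRefl.
exact: PresSym.
Qed.

Definition pres_one : presented := pres_class [::].
Definition pres_mul (a b : presented) : presented :=
  pres_class (repr a ++ repr b).
Definition pres_inv (a : presented) : presented :=
  pres_class (pres_inv_word (repr a)).

Lemma pres_mul_class u v :
  pres_mul (pres_class u) (pres_class v) = pres_class (u ++ v).
Proof. by apply/pres_classP; apply: PresCat; apply: pres_repr_class. Qed.

Lemma pres_inv_class u :
  pres_inv (pres_class u) = pres_class (pres_inv_word u).
Proof. by apply/pres_classP/pres_cong_inv/pres_repr_class. Qed.

Lemma pres_mulA : associative pres_mul.
Proof.
move=> a b c; rewrite -(pres_class_repr a) -(pres_class_repr b).
by rewrite -(pres_class_repr c) !pres_mul_class catA.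
Qed.

Lemma pres_mul1 : left_id pres_one pres_mul.
Proof. by move=> a; rewrite -(pres_class_repr a) pres_mul_class. Qed.

Lemma pres_mul1r : right_id pres_one pres_mul.
Proof. by move=> a; rewrite -(pres_class_repr a) pres_mul_class cats0. Qed.

Lemma pres_mulV : left_inverse pres_one pres_inv pres_mul.
Proof.
move=> a; rewrite -(pres_class_repr a) pres_inv_class pres_mul_class.
exact/pres_classP/pres_cong_mulVw.
Qed.

Lemma pres_mulrV : right_inverse pres_one pres_inv pres_mul.
Proof.
move=> a; rewrite -(pres_class_repr a) pres_inv_class pres_mul_class.
apply/pres_classP; have := pres_cong_mulVw (pres_inv_word (repr a)).
by rewrite pres_inv_wordK.
Qed.

HB.instance Definition _ := isGroup.Build presented
  pres_mulA pres_mul1 pres_mul1r pres_mulV pres_mulrV.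

Definition pres_gen (x : X) : presented := pres_class [:: (x, false)].

End PresentedGroup.

Local Open Scope group_scope.

Definition pres_eval (X : Type) (G : groupType) (f : X -> G)
    (u : pres_word X) : G :=
  \prod_(l <- u) (if l.2 then (f l.1)^-1 else f l.1).

Section PresentedLift.
Variables (X : choiceType) (R : pres_word X -> pres_word X -> Prop).
Variables (G : groupType) (f : X -> G).
Hypothesis fR : forall u v, R u v -> pres_eval f u = pres_eval f v.

(* The homomorphism < X | R > -> G induced by f. *)
Definition pres_lift of (forall u v, R u v -> pres_eval f u = pres_eval f v) :=
  fun a : presented R => pres_eval f (repr a).

Lemma pres_eval_cong u v : pres_cong R u v -> pres_eval f u = pres_eval f v.
Proof.
elim=> {u v} // [[x b]|u v w _ -> _ -> //|u u' v v' _ uu' _ vv'].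
  by rewrite /pres_eval !big_cons big_nil /=; case: b;
     rewrite /= mulg1 ?mulgV ?mulVg.
by rewrite /pres_eval !big_cat /= -!/(pres_eval f _) uu' vv'.
Qed.

Lemma pres_lift_class u : pres_lift fR (pres_class R u) = pres_eval f u.
Proof. exact/pres_eval_cong/pres_repr_class. Qed.

Lemma pres_lift_gen x : pres_lift fR (pres_gen R x) = f x.
Proof. by rewrite pres_lift_class /pres_eval big_seq1. Qed.

Lemma pres_lift_is_monoid_morphism : monoid_morphism (pres_lift fR).
Proof.
split=> [|a b].
  by rewrite [X in pres_lift _ X](_ : _ = pres_class R [::]) // pres_lift_class
    /pres_eval big_nil.
rewrite -(pres_class_repr a) -(pres_class_repr b).
rewrite [X in pres_lift _ X]pres_mul_class !pres_lift_class.
by rewrite /pres_eval big_cat.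
Qed.

HB.instance Definition _ := isUMagmaMorphism.Build _ _ (pres_lift fR)
  pres_lift_is_monoid_morphism.

End PresentedLift.

(* Generators carry their usual one-based indices. *)
Definition twin_index (n : nat) := {k : nat | 0 < k < n}.

Inductive twin_relation (n : nat) :
    pres_word (twin_index n) -> pres_word (twin_index n) -> Prop :=
| TwinSquare (i : twin_index n) :
    twin_relation [:: (i, false); (i, false)] [::]
| TwinCommute (i j : twin_index n) :
    (val i + 2 <= val j) || (val j + 2 <= val i) ->
    twin_relation [:: (i, false); (j, false)] [:: (j, false); (i, false)].

(* This is the trivial group for n = 1 (and for n = 0). *)
Definition twin (n : nat) : groupType := presented (@twin_relation n).

(* tgen n k is the generator s_k of T_n if 0 < k < n; the value 1 at the other
   indices is never used. *)
Definition tgen (n k : nat) : twin n :=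
  if insub k is Some i then pres_gen (@twin_relation n) i else 1.

Lemma tgen_sqr n k : tgen n k * tgen n k = 1.
Proof.
rewrite /tgen; case: insubP => [i _ _|_]; last by rewrite mulg1.
rewrite [LHS]pres_mul_class; apply/pres_classP/PresRel.
exact: TwinSquare.
Qed.

Lemma tgen_comm n i j : (i + 2 <= j) || (j + 2 <= i) ->
  tgen n i * tgen n j = tgen n j * tgen n i.
Proof.
move=> ij; rewrite /tgen; case: insubP => [i' _ ii'|_]; last by rewrite mulg1 mul1g.
case: insubP => [j' _ jj'|_]; last by rewrite mulg1 mul1g.
rewrite [LHS]pres_mul_class [RHS]pres_mul_class; apply/pres_classP/PresRel.
by apply: TwinCommute; rewrite ii' jj'.
Qed.

Lemma strand_right_subproof n u v : twin_relation u v ->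
  pres_eval (fun k : twin_index n => tgen n.+1 (val k)) u =
  pres_eval (fun k : twin_index n => tgen n.+1 (val k)) v.
Proof.
case=> [i|i j ij]; rewrite /pres_eval !big_cons !big_nil /= !mulg1.
  exact: tgen_sqr.
exact: tgen_comm.
Qed.

Lemma strand_left_subproof n u v : twin_relation u v ->
  pres_eval (fun k : twin_index n => tgen n.+1 (val k).+1) u =
  pres_eval (fun k : twin_index n => tgen n.+1 (val k).+1) v.
Proof.
case=> [i|i j ij]; rewrite /pres_eval !big_cons !big_nil /= !mulg1.
  exact: tgen_sqr.
by apply: tgen_comm; rewrite !addSn !ltnS.
Qed.

(* The maps beta |-> beta (x) I and beta |-> I (x) beta. *)
Definition strand_right (n : nat) : twin n -> twin n.+1 :=
  pres_lift (@strand_right_subproof n).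

Definition strand_left (n : nat) : twin n -> twin n.+1 :=
  pres_lift (@strand_left_subproof n).

HB.instance Definition _ n := UMagmaMorphism.copy (@strand_right n)
  (pres_lift (@strand_right_subproof n)).
HB.instance Definition _ n := UMagmaMorphism.copy (@strand_left n)
  (pres_lift (@strand_left_subproof n)).

Lemma strand_right_tgen n k : 0 < k < n ->
  strand_right (tgen n k) = tgen n.+1 k.
Proof.
move=> kn; rewrite /tgen; case: insubP => [i _ <-|]; last by rewrite kn.
by rewrite /strand_right pres_lift_gen.
Qed.

Lemma strand_left_tgen n k : 0 < k < n ->
  strand_left (tgen n k) = tgen n.+1 k.+1.
Proof.
move=> kn; rewrite /tgen; case: insubP => [i _ <-|]; last by rewrite kn.
by rewrite /strand_left pres_lift_gen.
Qed.

Definition word_elt (n : nat) (w : seq nat) : twin n := \prod_(k <- w) tgen n k.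

Definition down_up (n i : nat) : seq nat :=
  rev (index_iota i n.+1) ++ index_iota i.+1 n.+1.

Definition up_down (i : nat) : seq nat :=
  index_iota 1 i.+1 ++ rev (index_iota 1 i).

(* "Algorithm" is taken in the sense of Church's thesis: a (Kleene) partial
   recursive function.  A mere Rocq function into bool would not do, since
   classical choice produces one for every predicate. *)
Inductive recfun : nat -> Type :=
| RZero k : recfun k
| RSucc : recfun 1
| RProj k (i : 'I_k) : recfun k
| RComp k m (f : recfun m) (g : 'I_m -> recfun k) : recfun k
| RPrim k (f : recfun k) (g : recfun k.+2) : recfun k.+1
| RMin k (f : recfun k.+1) : recfun k.

(* rec_eval f v y: the computation of f on v terminates with value y.
   In the case of primitive recursion, h j is the value at recursion
   argument j; minimisation requires f to be defined below the result. *)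
Fixpoint rec_eval (k : nat) (f : recfun k) : k.-tuple nat -> nat -> Prop :=
  match f in recfun k return k.-tuple nat -> nat -> Prop with
  | RZero k => fun v y => y = 0
  | RSucc => fun v y => y = (thead v).+1
  | RProj k i => fun v y => y = tnth v i
  | RComp k m f g => fun v y =>
      exists2 w : m.-tuple nat,
        forall i, rec_eval (g i) v (tnth w i) & rec_eval f w y
  | RPrim k f g => fun v y =>
      exists h : nat -> nat,
        [/\ rec_eval f [tuple of behead v] (h 0),
            forall j, j < thead v ->
              rec_eval g [tuple of j :: h j :: behead v] (h j.+1)
          & y = h (thead v)]
  | RMin k f => fun v y =>
      rec_eval f [tuple of y :: v] 0 /\
      forall j, j < y -> exists z, rec_eval f [tuple of j :: v] z.+1
  end.

(* P is decidable on the inputs (n, w) satisfying D; the finite sequence w is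
   presented to the machine through its (bijective) code CodeSeq.code w, and
   nothing is required of the algorithm outside of D. *)
Definition algorithmically_decidable (D P : nat -> seq nat -> Prop) : Prop :=
  exists f : recfun 2, forall (n : nat) (w : seq nat), D n w ->
    exists b : bool,
      rec_eval f [tuple n; CodeSeq.code w] (nat_of_bool b) /\ (b <-> P n w).

Definition valid_input (n : nat) (w : seq nat) : Prop :=
  0 < n /\ all (fun k => 0 < k <= n) w.

(* Main.v *)
(* T_n acts on integer vectors indexed by the vertices of a path: firing a
   negates the entry at a and adds twice that entry to both neighbours (the dual
   geometric representation of a right-angled Coxeter group, as in Mozes'
   numbers game).  Starting from the all-ones vector and firing only positive
   entries, no entry ever vanishes and adjacent entries have positive sums;
   hence a negative entry at a means that a commutes to the front of the word.
   So every element has such a legal word, the last letter of which leaves a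
   negative entry behind, and an element is determined by where it sends the
   all-ones vector.  This solves the word problem.
   The subgroup of T_(n+1) coming from T_n is the image of the retraction that
   kills s_n (resp. s_1), and the coset representatives are involutions, so
   membership of alpha in the coset of d_i is the equality between alpha d_i
   and the word obtained from it by deleting all letters n (resp. 1).  This is
   tested for each i by playing the game on codes of lists. *)
Require Import Defs.
From HB Require Import structures.
From mathcomp Require Import all_boot all_order ssralg ssrnum ssrint zify boolp.

Set Implicit Arguments.
Unset Strict Implicit.
Unset Printing Implicit Defensive.
Import GRing.Theory.

(** * Partial recursive functions *)

Local Notation "v .[ i ]" := (nth 0 v i).

(** Arguments form a list read with [nth] and default 0, so that functions can be written without
    tuples or ordinals. *)
Definition computable (k : nat) (F : seq nat -> nat) : Prop :=
  exists f : recfun k, forall v : k.-tuple nat, rec_eval f v (F v).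

Lemma computable_ext k F G : F =1 G -> computable k F -> computable k G.
Proof. by move/funext => <-. Qed.

Lemma computable_comp k m G (Fs : seq nat -> seq nat) :
  computable m G -> (forall v, size v = k -> size (Fs v) = m) ->
  (forall i, i < m -> computable k (fun v => (Fs v).[i])) ->
  computable k (fun v => G (Fs v)).
Proof.
move=> [g gP] szF FP.
have /fin_all_exists[f fP] (i : 'I_m) : computable k (fun v => (Fs v).[i]).
  exact: FP.
exists (RComp g f) => v.
have szv : size (Fs v) == m by apply/eqP/szF; rewrite size_tuple.
exists (Tuple szv); last exact: (gP (Tuple szv)).
by move=> i; rewrite (tnth_nth 0); apply: fP.
Qed.

Lemma computable_nth k i : computable k (fun v => v.[i]).
Proof.
have [ik|ki] := ltnP i k.
  by exists (RProj (Ordinal ik)) => v /=; rewrite (tnth_nth 0).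
by exists (RZero k) => v /=; rewrite nth_default // size_tuple.
Qed.

Lemma computable_drop k d i : computable k (fun v => (drop d v).[i]).
Proof.
by apply: computable_ext (computable_nth k (d + i)) => v; rewrite nth_drop.
Qed.

Lemma computable_drop2 k d d' i :
  computable k (fun v => (drop d (drop d' v)).[i]).
Proof.
by apply: computable_ext (computable_drop k d' (d + i)) => v; rewrite [RHS]nth_drop.
Qed.

(** Composition abstracts the arguments into projections, so that each function need only be treated
    once, on bare variables. *)
Lemma computable1 (f : nat -> nat) k A : computable 1 (fun v => f v.[0]) ->
  computable k A -> computable k (fun v => f (A v)).
Proof.
move=> cf cA.
apply: (@computable_comp k 1 _ (fun v => [:: A v]) cf) => //.
by do ![case=> //].
Qed.

Lemma computable2 (f : nat -> nat -> nat) k A B :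
  computable 2 (fun v => f v.[0] v.[1]) ->
  computable k A -> computable k B -> computable k (fun v => f (A v) (B v)).
Proof.
move=> cf cA cB.
apply: (@computable_comp k 2 _ (fun v => [:: A v; B v]) cf) => //.
by do ![case=> //].
Qed.

Lemma computable3 (f : nat -> nat -> nat -> nat) k A B C :
  computable 3 (fun v => f v.[0] v.[1] v.[2]) ->
  computable k A -> computable k B -> computable k C ->
  computable k (fun v => f (A v) (B v) (C v)).
Proof.
move=> cf cA cB cC.
apply: (@computable_comp k 3 _ (fun v => [:: A v; B v; C v]) cf) => //.
by do ![case=> //].
Qed.

Lemma computable4 (f : nat -> nat -> nat -> nat -> nat) k A B C D :
  computable 4 (fun v => f v.[0] v.[1] v.[2] v.[3]) ->
  computable k A -> computable k B -> computable k C -> computable k D ->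
  computable k (fun v => f (A v) (B v) (C v) (D v)).
Proof.
move=> cf cA cB cC cD.
apply: (@computable_comp k 4 _ (fun v => [:: A v; B v; C v; D v]) cf) => //.
by do ![case=> //].
Qed.

(** * Closure properties of total recursive functions *)

Lemma computable_succ k A : computable k A -> computable k (fun v => (A v).+1).
Proof.
apply: (@computable1 succn); exists RSucc => v /=.
by rewrite /thead (tnth_nth 0).
Qed.

Lemma computable_const k c : computable k (fun=> c).
Proof.
elim: c => [|c IHc]; first by exists (RZero k).
exact: computable_succ.
Qed.

(** The loop from which the later functions are built: primitive recursion on a leading argument,
    for which [N v] is then substituted. The step sees the counter, the accumulator, then the
    parameters. *)
Lemma computable_iteri k (N B : seq nat -> nat)
    (S : seq nat -> nat -> nat -> nat) :
  computable k N -> computable k B ->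
  computable k.+2 (fun v => S (drop 2 v) v.[0] v.[1]) ->
  computable k (fun v => iteri (N v) (S v) (B v)).
Proof.
move=> cN [b bP] [s sP].
have : computable k.+1 (fun v => iteri v.[0] (S (behead v)) (B (behead v))).
  exists (RPrim b s) => v /=.
  exists (fun j => iteri j (S (behead v)) (B (behead v))); split.
  - exact: (bP [tuple of behead v]).
  - move=> j _ /=; have := sP [tuple of j :: iteri j (S (behead v))
      (B (behead v)) :: behead v].
    by rewrite /= drop0.
  - by rewrite /thead (tnth_nth 0).
move/(@computable_comp k k.+1 _ (fun v => N v :: v)); apply.
  by move=> v /= ->.
by case=> [|i] // _; apply: computable_nth.
Qed.

Lemma computable_pred k A : computable k A -> computable k (fun v => (A v).-1).
Proof.
apply: (@computable1 predn).
apply: (@computable_ext _ (fun v => iteri v.[0] (fun j _ => j) 0)).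
  by move=> v; case: v.[0].
by apply: (computable_iteri (S := fun v j a => j)); apply: computable_nth
  || apply: computable_const.
Qed.

Lemma computable_add k A B : computable k A -> computable k B ->
  computable k (fun v => A v + B v).
Proof.
apply: (@computable2 addn).
apply: (@computable_ext _ (fun v => iteri v.[1] (fun _ a => a.+1) v.[0])).
  by move=> v; elim: v.[1] => [|c /= ->]; rewrite ?addn0 ?addnS.
apply: (computable_iteri (S := fun v j a => a.+1)); try exact: computable_nth.
exact/computable_succ/computable_nth.
Qed.

Lemma computable_subn k A B : computable k A -> computable k B ->
  computable k (fun v => A v - B v).
Proof.
apply: (@computable2 subn).
apply: (@computable_ext _ (fun v => iteri v.[1] (fun _ a => a.-1) v.[0])).
  by move=> v; elim: v.[1] => [|c /= ->]; rewrite ?subn0 ?subnS.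
apply: (computable_iteri (S := fun v j a => a.-1)); try exact: computable_nth.
exact/computable_pred/computable_nth.
Qed.

Lemma computable_mul k A B : computable k A -> computable k B ->
  computable k (fun v => A v * B v).
Proof.
apply: (@computable2 muln).
apply: (@computable_ext _ (fun v => iteri v.[1] (fun _ a => v.[0] + a) 0)).
  by move=> v; elim: v.[1] => [|c /= ->]; rewrite ?muln0 ?mulnS.
apply: (computable_iteri (S := fun v j a => v.[0] + a));
  try (exact: computable_nth || exact: computable_const).
by apply: computable_add; [exact: computable_drop | exact: computable_nth].
Qed.

Lemma computable_negb k (A : seq nat -> bool) :
  computable k (fun v => A v) -> computable k (fun v => ~~ A v).
Proof.
move=> cA; apply: (@computable_ext _ (fun v => 1 - A v)).
  by move=> v; case: (A v).
by apply: computable_subn => //; apply: computable_const.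
Qed.

Lemma computable_andb k (A B : seq nat -> bool) :
  computable k (fun v => A v) -> computable k (fun v => B v) ->
  computable k (fun v => A v && B v).
Proof.
move=> cA cB; apply: (@computable_ext _ (fun v => A v * B v)).
  by move=> v; rewrite mulnb.
exact: computable_mul.
Qed.

Lemma computable_orb k (A B : seq nat -> bool) :
  computable k (fun v => A v) -> computable k (fun v => B v) ->
  computable k (fun v => A v || B v).
Proof.
move=> cA cB; apply: (@computable_ext _ (fun v => ~~ (~~ A v && ~~ B v))).
  by move=> v; rewrite negb_and !negbK.
by apply/computable_negb/computable_andb; apply: computable_negb.
Qed.

Lemma computable_leq k A B : computable k A -> computable k B ->
  computable k (fun v => A v <= B v).
Proof.
move=> cA cB; apply: (@computable_ext _ (fun v => 1 - (A v - B v))).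
  by move=> v; lia.
by apply: computable_subn; [exact: computable_const | exact: computable_subn].
Qed.

Lemma computable_eqn k A B : computable k A -> computable k B ->
  computable k (fun v => A v == B v).
Proof.
move=> cA cB; apply: (@computable_ext _ (fun v => (A v <= B v) && (B v <= A v))).
  by move=> v; rewrite eqn_leq.
by apply: computable_andb; apply: computable_leq.
Qed.

Lemma computable_if k (C : seq nat -> bool) A B : computable k (fun v => C v) ->
  computable k A -> computable k B ->
  computable k (fun v => if C v then A v else B v).
Proof.
move=> cC cA cB; apply: (@computable_ext _ (fun v => C v * A v + ~~ C v * B v)).
  by move=> v; case: (C v); rewrite ?mul1n ?mul0n ?addn0.
by apply: computable_add; apply: computable_mul => //; apply: computable_negb.
Qed.

Lemma computable_odd k A : computable k A -> computable k (fun v => odd (A v)).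
Proof.
apply: (@computable1 odd).
apply: (@computable_ext _ (fun v => iteri v.[0] (fun _ a => 1 - a) 0)).
  by move=> v; elim: v.[0] => [|c /= ->] //; case: odd.
apply: (computable_iteri (S := fun _ _ a => 1 - a)); try exact: computable_nth.
  exact: computable_const.
by apply: computable_subn; [exact: computable_const | exact: computable_nth].
Qed.

Lemma computable_half k A : computable k A -> computable k (fun v => (A v)./2).
Proof.
apply: (@computable1 half).
apply: (@computable_ext _ (fun v => iteri v.[0] (fun j a => odd j + a) 0)).
  by move=> v; elim: v.[0] => [|c /= ->] //; rewrite uphalf_half.
apply: (computable_iteri (S := fun _ j a => odd j + a));
  try (exact: computable_nth || exact: computable_const).
by apply: computable_add; [apply: computable_odd|]; apply: computable_nth.
Qed.

Lemma computable_expn k c A : computable k A -> computable k (fun v => c ^ A v).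
Proof.
apply: (@computable1 (expn c)).
apply: (@computable_ext _ (fun v => iteri v.[0] (fun _ a => c * a) 1)).
  by move=> v; elim: v.[0] => [|d /= ->] //; rewrite expnS.
apply: (computable_iteri (S := fun _ _ a => c * a));
  try (exact: computable_nth || exact: computable_const).
by apply: computable_mul; [exact: computable_const | exact: computable_nth].
Qed.

Lemma computable_all k N (P : seq nat -> pred nat) : computable k N ->
  computable k.+2 (fun v => P (drop 2 v) v.[0]) ->
  computable k (fun v => all (P v) (iota 0 (N v))).
Proof.
move=> cN cP.
apply: (@computable_ext _ (fun v => iteri (N v) (fun j a => P v j * a) 1)).
  move=> v; elim: (N v) => [|j IHj] //.
  by rewrite iteriS IHj -[j.+1]addn1 iotaD all_cat /= andbT mulnb andbC.
apply: (computable_iteri (S := fun v j a => P v j * a)) => //.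
  exact: computable_const.
by apply: computable_mul => //; apply: computable_nth.
Qed.

Lemma computable_has k N (P : seq nat -> pred nat) : computable k N ->
  computable k.+2 (fun v => P (drop 2 v) v.[0]) ->
  computable k (fun v => has (P v) (iota 0 (N v))).
Proof.
move=> cN cP.
apply: (@computable_ext _ (fun v => ~~ all (fun i => ~~ P v i) (iota 0 (N v)))).
  by move=> v; rewrite -has_predC; congr nat_of_bool; apply: eq_has => i /=;
    rewrite negbK.
by apply/computable_negb/(computable_all (P := fun v i => ~~ P v i)) => //;
  apply: computable_negb.
Qed.

Ltac computability := repeat lazymatch goal with
  | |- computable _ (fun v => nth 0 v _) => apply: computable_nth
  | |- computable _ (fun v => nth 0 (drop _ v) _) => apply: computable_drop
  | |- computable _ (fun v => nth 0 (drop _ (drop _ v)) _) =>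
      apply: computable_drop2
  | |- computable _ (fun _ => ?c) => apply: computable_const
  | |- computable _ (fun v => succn _) => apply: computable_succ
  | |- computable _ (fun v => predn _) => apply: computable_pred
  | |- computable _ (fun v => addn _ _) => apply: computable_add
  | |- computable _ (fun v => subn _ _) => apply: computable_subn
  | |- computable _ (fun v => muln _ _) => apply: computable_mul
  | |- computable _ (fun v => nat_of_bool (~~ _)) => apply: computable_negb
  | |- computable _ (fun v => nat_of_bool (_ && _)) => apply: computable_andb
  | |- computable _ (fun v => nat_of_bool (_ || _)) => apply: computable_orb
  | |- computable _ (fun v => nat_of_bool (leq _ _)) => apply: computable_leq
  | |- computable _ (fun v => nat_of_bool (eq_op _ _)) => apply: computable_eqn
  | |- computable _ (fun v => nat_of_bool (odd _)) => apply: computable_odd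
  | |- computable _ (fun v => half _) => apply: computable_half
  | |- computable _ (fun v => expn _ _) => apply: computable_expn
  | |- computable _ (fun v => nat_of_bool (all (@?P v) (iota 0 (@?N v)))) =>
      apply: (computable_all (N := N) (P := P)); cbv beta
  | |- computable _ (fun v => nat_of_bool (has (@?P v) (iota 0 (@?N v)))) =>
      apply: (computable_has (N := N) (P := P)); cbv beta
  | |- computable _ (fun v => if _ then _ else _) => apply: computable_if
  | |- computable _ (fun v => iteri (@?N v) (@?S v) (@?B v)) =>
      apply: (computable_iteri (N := N) (S := S) (B := B)); cbv beta
  | _ => assumption
  end.

(** * Lists of numbers handled through their codes *)

(* Halving until odd strips 2 ^ a off code (a :: s) = 2 ^ a * (2 * code s + 1). *)
Definition odd_part c := iteri c (fun _ x => if odd x then x else x./2) c.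
Definition code_tail c := (odd_part c)./2.

(** Each round removes one factor 2 until the number is odd, and then it stays fixed. Surplus rounds
    are harmless, so the code itself can bound the loop. *)
Lemma odd_part_iter j a c :
  iteri j (fun _ x => if odd x then x else x./2) (2 ^ a * c.*2.+1) =
  2 ^ (a - j) * c.*2.+1.
Proof.
elim: j => [|j IHj]; rewrite ?subn0 //= IHj.
have [ja|aj] := ltnP j a.
  rewrite -[a - j]prednK ?subn_gt0 // expnS -mulnA mul2n odd_double doubleK.
  by rewrite -subnS.
have /eqP -> : a - j == 0 by rewrite subn_eq0.
have /eqP -> : a - j.+1 == 0 by rewrite subn_eq0 leqW.
by rewrite mul1n /= odd_double.
Qed.

Lemma code_head_lt a s : a < CodeSeq.code (a :: s).
Proof. by have /andP[] := CodeSeq.ltn_code (a :: s). Qed.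

Lemma code_tail_code w : code_tail (CodeSeq.code w) = CodeSeq.code (behead w).
Proof.
case: w => [|a s] //; rewrite /code_tail /odd_part odd_part_iter.
have /eqP -> : a - CodeSeq.code (a :: s) == 0.
  by rewrite subn_eq0 ltnW // code_head_lt.
by rewrite mul1n /= uphalf_double.
Qed.

(** The head of a nonempty list is the number of rounds at which the halved number is still even. *)
Definition code_head c := iteri c
  (fun j acc => acc + ~~ odd (iteri j (fun _ x => if odd x then x else x./2) c)) 0.

Lemma code_head_code w : code_head (CodeSeq.code w) = head 0 w.
Proof.
case: w => [|a s] //; rewrite /code_head /=.
have aE m : iteri m (fun j acc => acc + ~~ odd (iteri j
    (fun _ x => if odd x then x else x./2) (2 ^ a * (CodeSeq.code s).*2.+1))) 0
    = minn a m.
  elim: m => [|m /= ->]; rewrite ?minn0 // odd_part_iter oddM oddX /= odd_double.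
  by lia.
by rewrite aE; apply/minn_idPl/ltnW/code_head_lt.
Qed.

Definition code_nth c i := code_head (iteri i (fun _ x => code_tail x) c).

Lemma code_nth_code w i : code_nth (CodeSeq.code w) i = w.[i].
Proof.
rewrite /code_nth.
have -> : iteri i (fun _ x => code_tail x) (CodeSeq.code w) =
    CodeSeq.code (drop i w).
  elim: i => [|i /= ->]; first by rewrite drop0.
  by rewrite code_tail_code -drop1 drop_drop.
by rewrite code_head_code -nth0 nth_drop addn0.
Qed.

Lemma computable_code_nth k A B : computable k A -> computable k B ->
  computable k (fun v => code_nth (A v) (B v)).
Proof.
apply: (@computable2 code_nth).
rewrite /code_nth; apply: (@computable1 code_head).
  by rewrite /code_head; computability.
computability; rewrite /code_tail; computability.
by apply: (@computable1 odd_part); rewrite /odd_part; computability.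
Qed.

(** A code grows at its front, so the list is built from its last entry, whence the index
    [m - j.+1]. *)
Definition code_mkseq m (f : nat -> nat) :=
  iteri m (fun j acc => 2 ^ f (m - j.+1) * (acc + acc).+1) 0.

Lemma code_mkseq_code m f : code_mkseq m f = CodeSeq.code (mkseq f m).
Proof.
rewrite /code_mkseq.
suff E j : j <= m -> iteri j (fun j acc => 2 ^ f (m - j.+1) * (acc + acc).+1) 0
    = CodeSeq.code [seq f i | i <- iota (m - j) j].
  by rewrite E // subnn.
elim: j => // j IHj jm; rewrite iteriS (IHj (ltnW jm)) addnn /=.
by rewrite -subSn // subSS.
Qed.

(** * Words in the twin group and the numbers game *)

Local Open Scope group_scope.

Lemma tgen_out n k : ~~ (0 < k < n)%N -> tgen n k = 1.
Proof. by move=> kn; rewrite /tgen insubN. Qed.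

Lemma word_elt_cons n a u : word_elt n (a :: u) = tgen n a * word_elt n u.
Proof. by rewrite /word_elt big_cons. Qed.

Lemma word_elt_cat n u v : word_elt n (u ++ v) = word_elt n u * word_elt n v.
Proof. by rewrite /word_elt big_cat. Qed.

Lemma word_elt_mulVr n u : word_elt n (rev u) * word_elt n u = 1.
Proof.
elim: u => [|a u IHu]; first by rewrite /word_elt big_nil mulg1.
rewrite rev_cons -cats1 word_elt_cat !word_elt_cons /word_elt big_nil mulg1.
by rewrite -mulgA (mulgA (tgen n a)) tgen_sqr mul1g.
Qed.

Lemma word_elt_rev n u : word_elt n (rev u) = (word_elt n u)^-1.
Proof. by apply: (mulIg (word_elt n u)); rewrite word_elt_mulVr mulVg. Qed.

Lemma word_elt_id n u : all (fun k => ~~ (0 < k < n)%N) u -> word_elt n u = 1.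
Proof.
elim: u => [|a u IHu] /=; first by rewrite /word_elt big_nil.
by case/andP=> an /IHu; rewrite word_elt_cons tgen_out // mul1g.
Qed.

Lemma word_elt_filter n u :
  word_elt n [seq k <- u | (0 < k < n)%N] = word_elt n u.
Proof.
elim: u => //= a u IHu; case: ifP => an; rewrite !word_elt_cons IHu //.
by rewrite tgen_out ?an // mul1g.
Qed.

Lemma word_elt_class n (u : pres_word (twin_index n)) :
  pres_class (@twin_relation n) u = word_elt n [seq val l.1 | l <- u].
Proof.
elim: u => [|[k b] u IHu]; first by rewrite /word_elt big_nil.
rewrite map_cons word_elt_cons -IHu -cat1s -pres_mul_class; congr (_ * _).
have kE : pres_class (@twin_relation n) [:: (k, false)] = tgen n (val k).
  by rewrite /tgen valK.
case: b; rewrite ?kE //=.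
rewrite (_ : pres_class _ _ = (tgen n (val k))^-1); last first.
  by rewrite -kE [RHS]pres_inv_class.
by apply: (mulIg (tgen n (val k))); rewrite mulVg tgen_sqr.
Qed.

Lemma twin_word n (b : twin n) :
  exists2 u, all (fun k => 0 < k < n)%N u & b = word_elt n u.
Proof.
exists [seq val l.1 | l <- repr b]; last by rewrite -word_elt_class pres_class_repr.
by apply/allP => _ /mapP[l _ ->]; exact: (valP l.1).
Qed.

(** * The numbers game and the word problem *)

Section Game.
Local Open Scope ring_scope.
Implicit Types (v : nat -> int) (u : seq nat).

Definition fire (a : nat) v (k : nat) : int :=
  if k == a then - v k
  else if (k == a.+1) || (k.+1 == a) then v k + v a + v a else v k.

Lemma fireK a : involutive (fire a).
Proof.
by move=> v; apply: funext => k; rewrite /fire; do ![case: ifP => //]; lia.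
Qed.

Lemma fireC a b v : (a + 2 <= b)%N || (b + 2 <= a)%N ->
  fire a (fire b v) = fire b (fire a v).
Proof.
move=> ab; apply: funext => k; rewrite /fire.
by do ![case: ifP => //]; lia.
Qed.

Definition play u v := foldr fire v u.

Lemma play_cat u u' v : play (u ++ u') v = play u (play u' v).
Proof. exact: foldr_cat. Qed.

Lemma play_revK u v : play (rev u) (play u v) = v.
Proof.
elim: u v => //= a u IHu v.
by rewrite rev_cons -cats1 play_cat /= fireK IHu.
Qed.

(** This makes the game an action of the twin group: the defining relations become [fireK] and
    [fireC], and signs of letters are irrelevant because [fire a] is an involution. *)
Lemma play_cong n (u u' : pres_word (twin_index n)) v :
  pres_cong (@twin_relation n) u u' ->
  play [seq val l.1 | l <- u] v = play [seq val l.1 | l <- u'] v.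
Proof.
move=> uu'; elim: uu' v => {u u'}.
- by move=> _ _ [i|i j ij] v /=; rewrite ?fireK // fireC.
- by move=> [i b] v /=; rewrite fireK.
- by [].
- by move=> u u' _ IH v.
- by move=> u1 u2 u3 _ IH _ IH' v; rewrite IH.
- by move=> u1 u2 u3 u4 _ IH _ IH' v; rewrite !map_cat !play_cat IH' IH.
Qed.

Lemma play_eq n u u' v :
  all (fun k => 0 < k < n)%N u -> all (fun k => 0 < k < n)%N u' ->
  word_elt n u = word_elt n u' -> play u v = play u' v.
Proof.
have lift u0 : all (fun k => 0 < k < n)%N u0 ->
    exists u1 : pres_word (twin_index n), u0 = [seq val l.1 | l <- u1].
  elim: u0 => [|a u0 IHu] /=; first by exists [::].
  by case/andP=> an /IHu[u1 ->]; exists ((exist _ a an, false) :: u1).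
move=> /lift[{}u ->] /lift[{}u' ->]; rewrite -!word_elt_class.
by move/pres_classP; apply: play_cong.
Qed.

Definition ones : nat -> int := fun=> 1.

(** The head of the list is the last move, as [play] folds from the right. *)
Fixpoint legal u :=
  if u is a :: u' then legal u' && (0 < play u' ones a) else true.

(** Firing a positive entry [x] replaces a neighbour [y] by [(x + y) + x], which is positive. The
    sum of the two becomes [- x + (y + 2x)], the same as before, and the sums across the next edges
    only grow. *)
Lemma legal_inv u : legal u ->
  forall k, play u ones k != 0 /\ 0 < play u ones k + play u ones k.+1.
Proof.
elim: u => [|a u IHu] //= /andP[/IHu{}IHu a0] k.
move: {IHu a0} (IHu k) (IHu k.+1) (IHu k.-1) a0; rewrite /fire.
set v := play u ones => -[v1 v2] [v3 v4] [v5 v6].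
(* At [k = 0] the instance at [k.-1] is the one at [k] again, hence the guard. *)
have v6' : (0 < k)%N -> 0 < v k.-1 + v k by move=> k0; move: v6; rewrite prednK.
move=> a0; have [ka|ka] := eqVneq k a.
  by subst a; rewrite /= eqxx /= gtn_eqF //; lia.
have [ka1|ka1] := eqVneq k.+1 a; first by subst a; rewrite orbT; lia.
have [ka2|ka2] := eqVneq k a.+1; last first.
  by rewrite eqSS (negPf ka) /=; case: (k.+2 =P a) => [ka3|_]; [subst a|]; lia.
subst k; move: (v6' isT) v2 => /=; rewrite !eqSS (negPf ka) /=.
by rewrite (_ : (a.+3 == a) = false) /=; lia.
Qed.

(** Look at the last move [b]. If [b = a], the tail works; a neighbour [b] would have left a
    positive entry at [a]; otherwise the entry at [a] was already negative, and [b] commutes with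
    the [a] supplied by induction. *)
Lemma legal_neg n u a : (0 < a < n)%N -> all (fun k => 0 < k < n)%N u ->
  legal u -> play u ones a < 0 ->
  exists u', [/\ all (fun k => 0 < k < n)%N u', legal u'
    & word_elt n u = word_elt n (a :: u')].
Proof.
move=> an; elim: u => [|b u IHu] //= /andP[bn un] /andP[lu b0].
have inv := legal_inv lu; rewrite /fire.
have [ab|ab] := eqVneq a b; first by subst b; exists u.
case: ifP => [adj|nadj] a0.
  exfalso; case/orP: adj => /eqP ab'.
  - by subst a; have := inv b; lia.
  - by subst b; have := inv a; lia.
have [u' [u'n lu' uE]] := IHu un lu a0.
have ab' : (a + 2 <= b)%N || (b + 2 <= a)%N by lia.
have u'an : all (fun k => 0 < k < n)%N (a :: u') by rewrite /= an.
exists (b :: u'); split; rewrite /= ?bn ?lu' //=.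
  (* Firing [a] does not touch the entry at [b], so that entry was positive before [a] as well. *)
  move: b0; rewrite (play_eq _ un u'an uE) /= /fire ifF ?ifF //; lia.
by rewrite word_elt_cons uE !word_elt_cons !mulgA (tgen_comm _ ab').
Qed.

(** A new letter at a positive entry is legal as it stands; at a negative entry it cancels against
    the [a] pulled out by [legal_neg]; and no entry is zero. *)
Lemma legal_word n u : all (fun k => 0 < k < n)%N u ->
  exists u', [/\ all (fun k => 0 < k < n)%N u', legal u'
    & word_elt n u = word_elt n u'].
Proof.
elim: u => [|a u IHu] /=; first by exists [::].
case/andP=> an /IHu[u' [u'n lu' uE]].
have [a0|a0|a0] := Order.TotalTheory.ltgtP 0 (play u' ones a).
- by exists (a :: u'); rewrite /= an lu' !word_elt_cons uE.
- have [u'' [u''n lu'' u'E]] := legal_neg an u'n lu' a0.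
  exists u''; split=> //.
  by rewrite word_elt_cons uE u'E word_elt_cons mulgA tgen_sqr mul1g.
- by have [] := legal_inv lu' a; rewrite -a0.
Qed.

(** A firing reads only the entry itself and the fired one, so entries from [n] on are never
    consulted. *)
Lemma play_local n u v v' : all (fun k => k < n)%N u ->
  (forall k, k < n -> v k = v' k)%N ->
  forall k, (k < n)%N -> play u v k = play u v' k.
Proof.
move=> un vv'; elim: u un => //= a u IHu /andP[an /IHu{}IHu] k kn.
by rewrite /fire !IHu.
Qed.

Lemma word_elt_eqP n u u' :
  all (fun k => 0 < k < n)%N u -> all (fun k => 0 < k < n)%N u' ->
  word_elt n u = word_elt n u' <->
  forall k, (k < n)%N -> play u ones k = play u' ones k.
Proof.
move=> un u'n; split=> [uu' k _|uu']; first by rewrite (play_eq _ un u'n uu').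
have ltn u0 : all (fun k => 0 < k < n)%N u0 -> all (fun k => k < n)%N u0.
  by apply: sub_all => k /andP[].
have u'un : all (fun k => 0 < k < n)%N (rev u' ++ u) by rewrite all_cat all_rev u'n.
(* A legal word for [u'^-1 u] must be empty: its last move would leave a negative entry, yet all
   entries below [n] have returned to 1. *)
have [[|a x] [xn lx xE]] := legal_word u'un.
  apply: (mulgI (word_elt n (rev u'))); rewrite word_elt_mulVr -word_elt_cat xE.
  by rewrite /word_elt big_nil.
have /andP[/andP[_ an] _] := xn.
have : play (a :: x) ones a = 1.
  rewrite -(play_eq _ u'un xn xE) play_cat -[RHS]/(ones a) -[in RHS](play_revK u' ones).
  by apply: (@play_local n) => //; apply: ltn; rewrite all_rev.
by move: lx => /= /andP[_]; rewrite /fire eqxx; lia.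
Qed.

End Game.

(** * Cosets of the subgroup with one strand fixed *)

Section Retractions.
Variable n : nat.

Lemma forget_right_subproof u v : @twin_relation n.+1 u v ->
  pres_eval (fun k : twin_index n.+1 => tgen n (val k)) u =
  pres_eval (fun k : twin_index n.+1 => tgen n (val k)) v.
Proof.
case=> [i|i j ij]; rewrite /pres_eval !big_cons !big_nil /= !mulg1.
  exact: tgen_sqr.
exact: tgen_comm.
Qed.

Lemma forget_left_subproof u v : @twin_relation n.+1 u v ->
  pres_eval (fun k : twin_index n.+1 => tgen n (val k).-1) u =
  pres_eval (fun k : twin_index n.+1 => tgen n (val k).-1) v.
Proof.
case=> [i|i j ij]; rewrite /pres_eval !big_cons !big_nil /= !mulg1.
  exact: tgen_sqr.
(* Indices are positive, so the truncated predecessor preserves distances. *)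
by apply: tgen_comm; move: (valP i) (valP j) ij => /=; lia.
Qed.

(** The generator [n] is killed because [tgen n n] is 1 by convention; in [forget_left] the
    generator 1 goes to [tgen n 0], which is also 1. *)
Definition forget_right : twin n.+1 -> twin n := pres_lift forget_right_subproof.
Definition forget_left : twin n.+1 -> twin n := pres_lift forget_left_subproof.

HB.instance Definition _ := UMagmaMorphism.copy forget_right
  (pres_lift forget_right_subproof).
HB.instance Definition _ := UMagmaMorphism.copy forget_left
  (pres_lift forget_left_subproof).

Lemma forget_right_word u : forget_right (word_elt n.+1 u) = word_elt n u.
Proof.
elim: u => [|a u IHu]; first by rewrite /word_elt !big_nil gmulf1.
rewrite !word_elt_cons gmulfM /= IHu; congr (_ * _).
have [an|an] := boolP (0 < a < n.+1)%N.
  by rewrite [in LHS]/tgen insubT; apply: pres_lift_gen.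
by rewrite !tgen_out // ?gmulf1 //; move: an; clear; lia.
Qed.

Lemma forget_left_word u :
  forget_left (word_elt n.+1 u) = word_elt n (map predn u).
Proof.
elim: u => [|a u IHu]; first by rewrite /word_elt !big_nil gmulf1.
rewrite map_cons !word_elt_cons gmulfM /= IHu; congr (_ * _).
have [an|an] := boolP (0 < a < n.+1)%N.
  by rewrite [in LHS]/tgen insubT; apply: pres_lift_gen.
by rewrite !tgen_out // ?gmulf1 //; move: an; clear; lia.
Qed.

(** The filter matters: for positive [n], the letter [n] is trivial in [twin n] but stands for a
    generator of [twin n.+1]. *)
Lemma strand_right_word u :
  strand_right (word_elt n u) = word_elt n.+1 [seq k <- u | 0 < k < n]%N.
Proof.
elim: u => [|a u IHu] /=; first by rewrite /word_elt !big_nil gmulf1.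
rewrite word_elt_cons gmulfM /= IHu; case: ifP => an.
  by rewrite word_elt_cons strand_right_tgen.
by rewrite tgen_out ?an // gmulf1 mul1g.
Qed.

Lemma strand_left_word u :
  strand_left (word_elt n u) = word_elt n.+1 (map succn [seq k <- u | 0 < k < n]%N).
Proof.
elim: u => [|a u IHu] /=; first by rewrite /word_elt !big_nil gmulf1.
rewrite word_elt_cons gmulfM /= IHu; case: ifP => an.
  by rewrite word_elt_cons strand_left_tgen.
by rewrite tgen_out ?an // gmulf1 mul1g.
Qed.

(** [forget_right] is a left inverse of [strand_right], so the image consists of the fixed points of
    their composite, which deletes [n] from words. *)
Lemma strand_right_image u :
  (exists b, word_elt n.+1 u = strand_right b) <->
  word_elt n.+1 u = word_elt n.+1 [seq k <- u | k != n].
Proof.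
have retract : strand_right (word_elt n u) = word_elt n.+1 [seq k <- u | k != n].
  rewrite strand_right_word -[RHS]word_elt_filter -filter_predI.
  by congr word_elt; apply: eq_filter => k /=; lia.
split=> [[b uE]|uE]; last by exists (word_elt n u); rewrite retract.
rewrite -retract -forget_right_word uE; have [x xn ->] := twin_word b.
by rewrite strand_right_word forget_right_word strand_right_word !(all_filterP xn).
Qed.

Lemma strand_left_image u :
  (exists b, word_elt n.+1 u = strand_left b) <->
  word_elt n.+1 u = word_elt n.+1 [seq k <- u | k != 1%N].
Proof.
have retract : strand_left (word_elt n (map predn u)) =
    word_elt n.+1 [seq k <- u | k != 1%N].
  rewrite strand_left_word -[RHS]word_elt_filter -filter_predI; congr word_elt.
  elim: u => //= a u IHu; case: ifP => an; case: ifP => an'; rewrite /= ?IHu //.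
  - by congr cons; lia.
  - by lia.
  - by lia.
split=> [[b uE]|uE]; last by exists (word_elt n (map predn u)); rewrite retract.
rewrite -retract -forget_left_word uE; have [x xn ->] := twin_word b.
rewrite strand_left_word forget_left_word strand_left_word (all_filterP xn).
by rewrite -[map predn _]map_comp (@map_id_in _ (predn \o succn)) ?(all_filterP xn).
Qed.

End Retractions.

(** * Palindromic coset representatives *)

(** A palindrome in involutions is its own inverse, so [d] can be moved to the other side of the
    equation. *)
Lemma coset_criterion n (G : twin n -> twin n.+1) z u d : rev d = d ->
  (forall u, (exists b, word_elt n.+1 u = G b) <->
     word_elt n.+1 u = word_elt n.+1 [seq k <- u | k != z]) ->
  (exists b, word_elt n.+1 u = G b * word_elt n.+1 d) <->
  word_elt n.+1 (u ++ d) = word_elt n.+1 [seq k <- u ++ d | k != z].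
Proof.
move=> dK <-; have dd : word_elt n.+1 d * word_elt n.+1 d = 1.
  by rewrite -[in X in X * _]dK word_elt_mulVr.
by split=> -[b E]; exists b; rewrite ?word_elt_cat -?E ?E -?mulgA ?dd ?mulg1 //;
  rewrite -E word_elt_cat -mulgA dd mulg1.
Qed.

Lemma rev_down_up n i : rev (down_up n i) = down_up n i.
Proof.
rewrite /down_up /index_iota subSS; have [in_|ni] := leqP i n.
  by rewrite subSn //= rev_cons cat_rcons rev_cat rev_cons revK cat_rcons.
have [-> ->] : (n.+1 - i = 0)%N /\ (n - i = 0)%N by lia.
by [].
Qed.

Lemma rev_up_down i : rev (up_down i) = up_down i.
Proof.
case: i => // i; have iE : index_iota 1 i.+2 = rcons (index_iota 1 i.+1) i.+1.
  by rewrite /index_iota !subn1 -[i.+2.-1]addn1 iotaD cats1.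
by rewrite /up_down iE rev_cat revK rev_rcons cat_rcons.
Qed.

(** The two truncated differences add up to the distance from [j] to the middle position [n - i],
    where the word reaches its lowest letter [i]. *)
Lemma mkseq_down_up n i : (0 < i <= n)%N ->
  mkseq (fun j => i + (n - i - j + (j - (n - i))))%N (n - i + (n - i)).+1 = down_up n i.
Proof.
move=> i_n; have sz : size (down_up n i) = (n - i + (n - i)).+1.
  by rewrite size_cat size_rev !size_iota; lia.
apply: (@eq_from_nth _ 0); rewrite ?sz ?size_mkseq // => j jn.
rewrite nth_mkseq // nth_cat size_rev size_iota; case: ltnP => jn'.
  by rewrite nth_rev size_iota // nth_iota; lia.
by rewrite nth_iota; lia.
Qed.

Lemma mkseq_up_down i : (0 < i)%N ->
  mkseq (fun j => i - (i.-1 - j + (j - i.-1)))%N (i.-1 + i.-1).+1 = up_down i.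
Proof.
move=> i0; have sz : size (up_down i) = (i.-1 + i.-1).+1.
  by rewrite size_cat size_rev !size_iota; lia.
apply: (@eq_from_nth _ 0); rewrite ?sz ?size_mkseq // => j jn.
rewrite nth_mkseq // nth_cat size_iota; case: ltnP => jn'.
  by rewrite nth_iota; lia.
by rewrite nth_rev size_iota ?nth_iota; lia.
Qed.

Local Close Scope group_scope.

(** * Playing the game on codes *)

(* The integer at position k is the difference of the entries 2k and 2k+1 of the
   coded list, so that firing needs no subtraction. *)
Definition game_step n z a c :=
  if (0 < a) && (a <= n) && ~~ (a == z) then
    code_mkseq (n.+1 + n.+1) (fun x =>
      if x./2 == a then code_nth c (a + a + ~~ odd x)
      else if (x./2 == a.+1) || (x./2.+1 == a) then
        code_nth c x + code_nth c (a + a + odd x) + code_nth c (a + a + odd x)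
      else code_nth c x)
  else c.

Definition game_init n := code_mkseq (n.+1 + n.+1) (fun x => ~~ odd x).

(* Letters outside 1..n, as well as z, are skipped; z = 0 skips nothing more. *)
Definition game n z len letter :=
  iteri len (fun j c => game_step n z (letter j) c) (game_init n).

Definition represents n c (v : nat -> int) :=
  forall k, k <= n ->
    v k = ((code_nth c (k + k))%:Z - (code_nth c (k + k).+1)%:Z)%R.

Lemma code_nth_mkseq m f x : x < m -> code_nth (code_mkseq m f) x = f x.
Proof. by move=> xm; rewrite code_mkseq_code code_nth_code nth_mkseq. Qed.

Lemma represents_init n : represents n (game_init n) ones.
Proof.
by move=> k kn; rewrite !code_nth_mkseq ?leq_add //= addnn ?odd_double //; lia.
Qed.

(** Negating an entry swaps its two parts; adding entries adds parts of equal parity. *)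
Lemma represents_step n z a c v : represents n c v ->
  represents n (game_step n z a c)
    (if (0 < a <= n) && (a != z) then fire a v else v).
Proof.
move=> cv; rewrite /game_step; case: ifP => // /andP[/andP[a0 an] _] k kn.
rewrite !code_nth_mkseq; [|lia..].
rewrite !addnn /= odd_double uphalf_double doubleK /fire /= -!addnn addn0 addn1.
case: eqP => [->|_]; last case: ifP => _; rewrite ?cv //.
  by lia.
by lia.
Qed.

(** The machine fires letters from left to right and [play] from right to left, hence the reversal:
    the game computes the action of the inverse. *)
Lemma represents_game n z len letter :
  represents n (game n z len letter)
    (play (rev [seq k <- mkseq letter len | (0 < k <= n) && (k != z)]) ones).
Proof.
elim: len => [|len IHlen]; first exact: represents_init.
rewrite mkseqS filter_rcons.
have := @represents_step n z (letter len) _ _ IHlen.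
by case: ifP => // _; rewrite rev_rcons.
Qed.

(** Equality of two differences, cross-added to avoid subtraction. *)
Definition same_game n z len letter := all (fun k =>
  code_nth (game n 0 len letter) (k + k) +
    code_nth (game n z len letter) (k + k).+1 ==
  code_nth (game n 0 len letter) (k + k).+1 +
    code_nth (game n z len letter) (k + k)) (iota 0 n.+1).

Lemma same_gameP n z len letter :
  same_game n z len letter <->
  word_elt n.+1 (mkseq letter len) =
    word_elt n.+1 [seq k <- mkseq letter len | k != z].
Proof.
have fE y (u := [seq k <- mkseq letter len | k != y]) :
    (word_elt n.+1 u)^-1%g = word_elt n.+1 (rev
      [seq k <- mkseq letter len | (0 < k <= n) && (k != y)]).
  by rewrite word_elt_rev filter_predI word_elt_filter.
have f0 : word_elt n.+1 (mkseq letter len) =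
    word_elt n.+1 [seq k <- mkseq letter len | k != 0].
  rewrite -word_elt_filter -[RHS]word_elt_filter -filter_predI.
  by congr word_elt; apply: eq_filter => k /=; lia.
have valid y : all (fun k => 0 < k < n.+1) (rev
    [seq k <- mkseq letter len | (0 < k <= n) && (k != y)]).
  by rewrite all_rev filter_predI filter_all.
have invE (x y : twin n.+1) : x = y <-> (x^-1 = y^-1)%g.
  by split=> [-> //|/invg_inj].
rewrite f0; apply: iff_trans (iff_sym (invE _ _)); rewrite !fE.
apply: iff_trans (iff_sym (word_elt_eqP (valid 0) (valid z))).
split=> [/allP same k kn|same].
  rewrite !represents_game //.
  have kI : k \in iota 0 n.+1 by rewrite mem_iota.
  by have /eqP := same k kI; lia.
apply/allP => k; rewrite mem_iota => /= kn; apply/eqP.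
by have := same k kn; rewrite !represents_game //; lia.
Qed.

(** * Recursiveness of the coset test *)

Lemma computable_game_step k A B C D :
  computable k A -> computable k B -> computable k C -> computable k D ->
  computable k (fun v => game_step (A v) (B v) (C v) (D v)).
Proof.
apply: (@computable4 game_step); rewrite /game_step /code_mkseq.
by computability; do ?[apply: computable_code_nth; computability].
Qed.

(** This lets the code stand in for the length of the word, which is never computed. *)
Lemma size_code w : size w <= CodeSeq.code w.
Proof.
elim: w => //= a w IHw; rewrite (leq_trans (_ : _ <= (CodeSeq.code w).*2.+1)) //.
  by rewrite ltnS -addnn (leq_trans IHw) ?leq_addr.
by rewrite leq_pmull ?expn_gt0.
Qed.

(** Positions past the end read 0, and the letter 0 is trivial. *)
Lemma word_elt_pad n (p : pred nat) w m : size w <= m ->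
  word_elt n [seq k <- mkseq (nth 0 w) m | p k] = word_elt n [seq k <- w | p k].
Proof.
move=> wm; rewrite -(subnKC wm) /mkseq iotaD map_cat filter_cat word_elt_cat.
rewrite -[map _ (iota 0 _)]/(mkseq _ _) mkseq_nth [X in (_ * X)%g]word_elt_id ?mulg1 //.
apply/allP => k; rewrite mem_filter => /andP[_ /mapP[j]]; rewrite mem_iota.
by case/andP=> wj _ ->; rewrite nth_default.
Qed.

(** Common form of both halves: [z] gives the deleted letter, while [len] and [d] give the lengths
    and letters of the representatives. The test is a search over [i], bounded by [n]. *)
Lemma decidable_coset (z : nat -> nat) (len : nat -> nat -> nat)
    (d : nat -> nat -> nat -> nat) (P : nat -> seq nat -> Prop) :
  computable 1 (fun v => z v.[0]) ->
  computable 2 (fun v => len v.[0] v.[1]) ->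
  computable 3 (fun v => d v.[0] v.[1] v.[2]) ->
  (forall n w, valid_input n w -> P n w <-> exists2 i, 0 < i <= n &
     word_elt n.+1 (w ++ mkseq (d n i) (len n i)) =
     word_elt n.+1 [seq k <- w ++ mkseq (d n i) (len n i) | k != z n]) ->
  algorithmically_decidable valid_input P.
Proof.
move=> cz clen cd PE.
(* The input word, padded by zeros to the length [c] of its own code, followed by the
   representative. *)
pose letter n c i j := if j < c then code_nth c j else d n i (j - c).
pose query n c := has (fun i =>
  same_game n (z n) (c + len n i.+1) (letter n c i.+1)) (iota 0 n).
have [f fP] : computable 2 (fun v => query v.[0] v.[1]).
  rewrite /query /same_game; have cletter k A B C D : computable k A ->
      computable k B -> computable k C -> computable k D ->
      computable k (fun v => letter (A v) (B v) (C v) (D v)).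
    apply: (@computable4 letter); rewrite /letter; computability.
      by apply: computable_code_nth; computability.
    by apply: (@computable3 d) => //; computability.
  have cgame k A B C D : computable k A ->
      computable k B -> computable k C -> computable k D ->
      computable k (fun v => game (A v) (B v) (C v + len (A v) (D v))
        (letter (A v) (C v) (D v))).
    apply: (@computable4 (fun n z c i => game n z (c + len n i) (letter n c i))).
    rewrite /game /game_init /code_mkseq; computability.
    - by apply: (@computable2 len) => //; computability.
    - by apply: computable_game_step; computability; apply: cletter; computability.
  computability; (apply: computable_code_nth; computability);
    apply: cgame; computability; exact: (computable1 cz (computable_drop2 _ _ _ _)).
exists f => n w nw; exists (query n (CodeSeq.code w)); split; first exact: (fP [tuple n; _]).
rewrite (PE n w nw).
suff E i : same_game n (z n) (CodeSeq.code w + len n i) (letter n (CodeSeq.code w) i) <->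
    word_elt n.+1 (w ++ mkseq (d n i) (len n i)) =
     word_elt n.+1 [seq k <- w ++ mkseq (d n i) (len n i) | k != z n].
  split=> [/hasP[i]|[i /andP[i0 i_n] /E iP]].
    by rewrite mem_iota => /= i_n /E iP; exists i.+1.
  by apply/hasP; exists i.-1; rewrite ?mem_iota ?prednK.
have letterE (p : pred nat) : word_elt n.+1
      [seq k <- mkseq (letter n (CodeSeq.code w) i) (CodeSeq.code w + len n i) | p k] =
    word_elt n.+1 [seq k <- w ++ mkseq (d n i) (len n i) | p k].
  rewrite /mkseq iotaD map_cat !filter_cat !word_elt_cat; congr (_ * _)%g.
    rewrite -(word_elt_pad _ _ (size_code w)); congr (word_elt _ (filter _ _)).
    apply/eq_in_map => j; rewrite mem_iota /letter => /= ->.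
    exact: code_nth_code.
  rewrite -[0 + _]addnC iotaDl -map_comp.
  congr (word_elt _ (filter _ _)); apply: eq_map => j /=.
  by rewrite /letter ltnNge leq_addr addKn.
apply: iff_trans (same_gameP _ _ _ _) _.
by have := letterE predT; rewrite !filter_predT letterE => ->.
Qed.

Local Open Scope group_scope.

Theorem theorem3p1 :
  algorithmically_decidable valid_input
    (fun (n : nat) (w : seq nat) =>
       exists (beta : twin n) (i : nat),
         (0 < i <= n)%N /\
         word_elt n.+1 w = strand_right beta * word_elt n.+1 (down_up n i)) /\
  algorithmically_decidable valid_input
    (fun (n : nat) (w : seq nat) =>
       exists (beta : twin n) (i : nat),
         (0 < i <= n)%N /\
         word_elt n.+1 w = strand_left beta * word_elt n.+1 (up_down i)).
Proof.
split.
  apply: (@decidable_coset id (fun n i => (n - i + (n - i)).+1)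
    (fun n i j => i + (n - i - j + (j - (n - i))))%N); try by computability.
  move=> n w _; split=> [[b [i [i_n E]]]|[i i_n]].
    exists i => //; rewrite mkseq_down_up //.
    by apply/(coset_criterion w (rev_down_up n i) (@strand_right_image n)); exists b.
  rewrite mkseq_down_up // => E.
  by have [b ?] := (coset_criterion w (rev_down_up n i) (@strand_right_image n)).2 E;
    exists b, i.
apply: (@decidable_coset (fun=> 1%N) (fun _ i => (i.-1 + i.-1).+1)
  (fun _ i j => i - (i.-1 - j + (j - i.-1)))%N); try by computability.
move=> n w _; split=> [[b [i [i_n E]]]|[i i_n]]; have /andP[i0 _] := i_n.
  exists i => //; rewrite mkseq_up_down //.
  by apply/(coset_criterion w (rev_up_down i) (@strand_left_image n)); exists b.
rewrite mkseq_up_down // => E.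
by have [b ?] := (coset_criterion w (rev_up_down i) (@strand_left_image n)).2 E;
  exists b, i.
Qed.
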